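(* Suppose that $\mathcal{I}=\mathsf{nwd}$ or $\mathcal{I}=\mathsf{null}$ (regarded as ideals on $\omega$). Then for every $\boldsymbol{a}\in\mathbb{Z}^\omega$ we have $\mathsf{H}_{\boldsymbol{a}}(\mathcal{I})=\mathbb{T}$ if and only if $\mathrm{supp}(\boldsymbol{a})\in\mathcal{I}$.
   Context: $\omega=\{0,1,2,\dots\}$; $\mathbb{T}=\mathbb{R}/\mathbb{Z}$; $\|x\|:=\min\{|x-z|:z\in\mathbb{Z}\}$. Let $D:=\mathbb{Q}\cap[0,1]$. $\mathsf{nwd}:=\{A\subseteq D:A\text{ is nowhere dense}\}$ and $\mathsf{null}:=\{A\subseteq D:\lambda(\overline{A})=0\}$, where the closure is taken in the usual topology of $[0,1]$ and $\lambda$ is Lebesgue measure on $[0,1]$. These ideals on the countably infinite set $D$ are regarded as ideals on $\omega$ through a given bijection $e:\omega\to D$, i.e. $S\subseteq\omega$ is in the ideal iff $e[S]$ is. For an ideal $\mathcal{I}$ on $\omega$ and $\boldsymbol{a}=(a_n:n\in\omega)\in\mathbb{Z}^\omega$, $\mathrm{supp}(\boldsymbol{a}):=\{n\in\omega:a_n\ne0\}$ and $\mathsf{H}_{\boldsymbol{a}}(\mathcal{I}):=\{x\in\mathbb{T}:\{n\in\omega:\|a_nx\|\ge\varepsilon\}\in\mathcal{I}\text{ for all }\varepsilon>0\}$. *)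

(* Defs.v *)
From HB Require Import structures.
From mathcomp Require Import all_boot all_order all_algebra ring_quotient.
From mathcomp Require Import all_classical all_reals all_analysis.
Import Order.TTheory GRing.Theory Num.Theory.
Import numFieldNormedType.Exports.
Set Implicit Arguments.
Unset Strict Implicit.
Unset Printing Implicit Defensive.
Local Open Scope classical_set_scope.
Local Open Scope ring_scope.
Local Open Scope quotient_scope.

(* [Num.int_num_subdef] is the predicate underlying the qualifier [Num.int]:
   it holds of x iff x = m%:~R for some m : int. *)
Definition integers (R : realType) : zmodClosed R :=
  GRing.ZmodClosed.clone R (@Num.int_num_subdef R) _.

Definition circle (R : realType) : zmodType := Quotient.quot (integers R).

Lemma circle_piP (R : realType) (x y : R) :
  reflect (exists m : int, x - y = m%:~R) (x == y %[mod circle R]).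
Proof. by rewrite -Quotient.idealrBE; exact: intrP. Qed.

Lemma circle_piMz (R : realType) (x : R) (m : int) :
  \pi_(circle R) (x *~ m) = (\pi_(circle R) x) *~ m.
Proof. exact: (raddfMz (\pi_(Quotient.quot (integers R)))). Qed.

Definition dist_int (R : realType) (x : R) : R :=
  inf [set `|x - z%:~R| | z in [set: int]].

Lemma dist_int_le (R : realType) (x : R) (m : int) : dist_int x <= `|x - m%:~R|.
Proof.
apply: ge_inf; last by exists m.
by exists 0 => _ [z _ <-].
Qed.

(* The infimum in [dist_int] is a minimum. *)
Lemma dist_int_min (R : realType) (x : R) :
  exists m : int, dist_int x = `|x - m%:~R|.
Proof.
pose f := Num.floor x; have /andP[fx xf] := floor_itv x.
pose u := Num.min `|x - f%:~R| `|x - (f + 1)%:~R|.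
suff ux : dist_int x = u.
  by rewrite ux /u /Num.min; case: ifP => _; [exists f|exists (f + 1)].
apply/eqP; rewrite eq_le; apply/andP; split.
  by rewrite le_min !dist_int_le.
apply: lb_le_inf; first by exists `|x - 0%:~R|, 0.
move=> _ [z _ <-]; rewrite ge_min; case: (lerP z f) => [zf|fz].
  have zf' : z%:~R <= f%:~R :> R by rewrite ler_int.
  apply/orP; left.
  by rewrite !ger0_norm ?subr_ge0 ?(le_trans zf')// lerD2l lerN2.
have fz' : (f + 1)%:~R <= z%:~R :> R by rewrite ler_int lezD1.
apply/orP; right; have xz := lt_le_trans xf fz'.
by rewrite !ltr0_norm ?subr_lt0// lerN2 lerD2l lerN2.
Qed.

Lemma dist_intDz (R : realType) (x : R) (m : int) :
  dist_int (x + m%:~R) = dist_int x.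
Proof.
congr inf; apply/seteqP; split=> _ [z _ <-].
  by exists (z - m) => //; rewrite rmorphB opprB addrA.
by exists (z + m) => //; rewrite rmorphD/= (addrC z%:~R) addrKA.
Qed.

Definition circle_norm (R : realType) (x : circle R) : R := dist_int (repr x).

Lemma circle_norm_pi (R : realType) (x : R) :
  circle_norm (\pi_(circle R) x) = dist_int x.
Proof.
rewrite /circle_norm.
have /eqP/circle_piP[m] := reprK (\pi_(circle R) x).
by move/eqP; rewrite subr_eq addrC => /eqP ->; exact: dist_intDz.
Qed.

Definition D (R : realType) : set R :=
  [set x | 0 <= x <= 1 /\ exists q : rat, x = ratr q].
Arguments D R : clear implicits.

(* [subspace `[0, 1]] keeps all of R as carrier and isolates the points outside
   [0, 1], so closures and interiors of subsets of [0, 1] taken in it are the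
   ones relative to [0, 1]. *)
Definition unit_space (R : realType) : topologicalType :=
  subspace (`[0, 1]%classic : set R).

Definition nwd (R : realType) : set (set R) :=
  [set A | A `<=` D R /\
    interior (closure (A : set (unit_space R))) = set0].
Arguments nwd R : clear implicits.

Definition null (R : realType) : set (set R) :=
  [set A | A `<=` D R /\
    @lebesgue_measure R (closure (A : set (unit_space R))) = 0%E].
Arguments null R : clear implicits.

Definition ideal_on_omega (T : Type) (e : nat -> T) (J : set (set T)) :
  set (set nat) := [set S | J (e @` S)].

Definition supp (a : nat -> int) : set nat := [set n | a n != 0].

Definition H (R : realType) (a : nat -> int) (I : set (set nat)) :
    set (circle R) :=
  [set x | forall eps : R, 0 < eps ->
    I [set n | eps <= circle_norm (x *~ a n)]].
Arguments H R a I : clear implicits.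

(* Main.v *)
Require Import Defs.
From HB Require Import structures.
From mathcomp Require Import all_boot all_order all_algebra ring_quotient.
From mathcomp Require Import all_classical all_reals all_analysis.
From mathcomp Require Import ring lra.
Import Order.TTheory GRing.Theory Num.Theory.
Import numFieldNormedType.Exports.

Local Open Scope classical_set_scope.
Local Open Scope ring_scope.

Set Implicit Arguments.
Unset Strict Implicit.

(** If the support is in the ideal then so is each set of indices n with
    ||a_n x|| >= eps > 0, because ||0|| = 0. The content is the converse: from a
    support outside the ideal one must find a single bad x.

    A generic x, in the sense of Baire category, is bad. Two facts about it
    suffice. First, m x is not an integer for any m != 0. Secondly, for each
    member U of a countable family of balls, either a is bounded on the indices
    n with e_n in U, or some such n has ||a_n x|| > 1/4. Both are countably many
    dense open conditions: when |m| is large, the points x with m x in Z + 1/2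
    meet any given open set ([dist_int_half_dense], [generic_point]).

    Let A be the image of the support and let y be in its closure. If a is
    unbounded near y, then y is in the closure of the single set
    {e_n : ||a_n x|| >= 1/4}. If a is bounded on some ball U around y, only
    finitely many nonzero multipliers m occur there, so ||m x|| has a positive
    minimum delta over them, and the part of A in U lies in
    {e_n : ||a_n x|| >= delta} ([generic_dichotomy]). When x is in H, each set
    {e_n : ||a_n x|| >= eps} is in the ideal; so the closure of A is covered by
    the closure of one member of the ideal and by countably many open sets in
    which A has a trace in the ideal. For both ideals this puts A in the
    ideal: the null one by countable subadditivity, the nowhere dense one
    because a nonempty open set inside the closure of A, if not contained in the
    closure of that one member, meets one of those open sets
    ([null_locally_detected], [nwd_locally_detected]). *)

(** * Distance to the nearest integer *)

Lemma dist_int_ge0 (R : realType) (x : R) : 0 <= dist_int x.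
Proof. by have [m ->] := dist_int_min x. Qed.

Lemma dist_int_eq0 (R : realType) (x : R) :
  dist_int x = 0 -> exists m : int, x = m%:~R.
Proof.
have [m ->] := dist_int_min x => /eqP; rewrite normr_eq0 subr_eq0 => /eqP ->.
by exists m.
Qed.

Lemma dist_int_intr (R : realType) (m : int) : dist_int (m%:~R : R) = 0.
Proof.
apply/eqP; rewrite eq_le dist_int_ge0 andbT.
by rewrite (le_trans (dist_int_le _ m))// subrr normr0.
Qed.

Lemma dist_int_half_ge (R : realType) (j : int) :
  2^-1 <= dist_int (j%:~R + 2^-1 : R).
Proof.
rewrite addrC dist_intDz; have [m ->] := dist_int_min (2^-1 : R).
have [m0|m1] := lerP m 0.
  have : m%:~R <= 0%:~R :> R by rewrite ler_int.
  move=> m0R; rewrite ger0_norm; lra.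
have m1R : (1 + 0)%:~R <= m%:~R :> R by rewrite ler_int addrC lezD1.
rewrite ler0_norm; lra.
Qed.

Lemma dist_int_lip (R : realType) (x y : R) :
  dist_int x <= dist_int y + `|x - y|.
Proof.
have [m ->] := dist_int_min y; apply: le_trans (dist_int_le x m) _.
by rewrite [leRHS]addrC; exact: ler_distD.
Qed.

Lemma continuous_dist_int (R : realType) : continuous (@dist_int R).
Proof.
move=> x; apply/cvgrPdist_lt => eps eps0; near=> y.
have xy : `|x - y| < eps by near: y; exact: cvgr_dist_lt.
have := dist_int_lip x y; have := dist_int_lip y x; rewrite (distrC y).
rewrite ltr_norml => *; apply/andP; split; lra.
Unshelve. all: by end_near. Qed.

Lemma open_dist_int_gt (R : realType) (t : R) (m : int) :
  open [set x : R | t < dist_int (x *~ m)].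
Proof.
have -> : [set x : R | t < dist_int (x *~ m)] =
    (@dist_int R \o *%R^~ m%:~R) @^-1` [set y | t < y].
  by apply/seteqP; split=> x /=; rewrite mulrzr.
apply: open_comp; last exact: open_gt.
move=> x _; apply: continuous_comp; first exact: mulrr_continuous.
exact: continuous_dist_int.
Qed.

(** Consecutive points x with m x in Z + 1/2 are 1/|m| apart, so these points
    enter any fixed ball as soon as |m| exceeds the inverse of its radius. *)
Lemma dist_int_half_dense (R : realType) (O : set R) : open O -> O !=set0 ->
  exists N : nat, forall m : int, (N <= `|m|)%N ->
    exists2 x, O x & 2^-1 <= dist_int (x *~ m).
Proof.
move=> oO [c Oc].
have /nbhs_ballP[r /= r0 rO] : nbhs c O by exact: open_nbhs_nbhs.
exists (Num.truncn r^-1).+1 => m Nm.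
have rm : r^-1 < `|m%:~R : R|.
  rewrite -intr_norm -abszE (lt_le_trans (truncnS_gt _))//.
  by rewrite -pmulrn ler_nat.
have m0 : m%:~R != 0 :> R by rewrite -normr_gt0 (lt_trans _ rm)// invr_gt0.
(* (j + 1/2) / m is the point nearest to the centre c: |m c - j - 1/2| <= 1/2. *)
pose j := Num.floor (c * m%:~R).
exists ((j%:~R + 2^-1) / m%:~R); last first.
  by rewrite -mulrzr divfK// dist_int_half_ge.
apply: rO; rewrite -ball_normE /=.
have -> : c - (j%:~R + 2^-1) / m%:~R = (c * m%:~R - (j%:~R + 2^-1)) / m%:~R.
  by field.
rewrite normrM normfV ltr_pdivrMr ?normr_gt0//.
have rm1 : 1 < r * `|m%:~R|.
  by rewrite -(ltr_pM2l r0) mulfV ?gt_eqF// in rm.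
apply: le_lt_trans rm1.
have /andP[] := floor_itv (c * m%:~R); rewrite -/j intrD => *.
rewrite ler_norml; apply/andP; split; lra.
Qed.

(** * Generic points *)

(** Baire's theorem for the two kinds of open conditions described above, one for
    each integer m and one for each index i. Allowing boundedness as an
    alternative makes the second kind dense whatever a and P are. *)
Lemma generic_point (R : realType) (a : nat -> int) (P : nat -> set nat) :
  exists x : R,
    (forall m : int, m != 0 -> 0 < dist_int (x *~ m)) /\
    forall i, (exists N : nat, forall n, P i n -> (`|a n| <= N)%N) \/
              (exists2 n, P i n & 4^-1 < dist_int (x *~ a n)).
Proof.
pose bdd i := exists N : nat, forall n, P i n -> (`|a n| <= N)%N.
pose G (s : int + nat) : set R := match s with
  | inl m => [set x | m != 0 -> 0 < dist_int (x *~ m)]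
  | inr i => [set x | bdd i \/ exists2 n, P i n & 4^-1 < dist_int (x *~ a n)]
  end.
have openG s : open (G s).
  case: s => [m|i].
    have [->|m0] := eqVneq m 0.
      have -> : G (inl 0) = setT by apply/seteqP; split=> // x _; rewrite /= eqxx.
      exact: openT.
    have -> : G (inl m) = [set x : R | 0 < dist_int (x *~ m)].
      by apply/seteqP; split=> x /=; rewrite m0; [apply|].
    exact: open_dist_int_gt.
  have [bi|nbi] := pselect (bdd i).
    have -> : G (inr i) = setT by apply/seteqP; split=> // x _; left.
    exact: openT.
  have -> : G (inr i) =
      \bigcup_(n in P i) [set x : R | 4^-1 < dist_int (x *~ a n)].
    by apply/seteqP; split=> x [] // n; right; exists n.
  by apply: bigcup_open => n _; exact: open_dist_int_gt.
have denseG s : dense (G s).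
  move=> O O0 oO; have [N HN] := dist_int_half_dense oO O0.
  case: s => [m|i].
    have [->|m0] := eqVneq m 0.
      by have [x Ox] := O0; exists x; split=> //=; rewrite eqxx.
    (* Only large multipliers are controlled, and a multiple of m x that is not
       an integer forces m x not to be one. *)
    have Nm : (N <= `|(m * N.+1%:Z)%R|)%N.
      rewrite abszM absz_nat (@leq_trans N.+1)// leq_pmull// absz_gt0//.
    have [x Ox xm] := HN _ Nm; exists x; split=> //= _.
    rewrite lt_def dist_int_ge0 andbT; apply/eqP => /dist_int_eq0[k xk].
    by move: xm; rewrite mulrzA xk -mulrzA dist_int_intr; lra.
  have [bi|nbi] := pselect (bdd i).
    by have [x Ox] := O0; exists x; split=> //=; left.
  have [n Pn Nn] : exists2 n, P i n & (N <= `|a n|)%N.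
    apply: contrapT => h; apply: nbi; exists N => n Pn.
    by rewrite leqNgt; apply/negP => /ltnW Nn; apply: h; exists n.
  have [x Ox xm] := HN _ Nn; exists x; split=> //=; right; exists n => //.
  by apply: lt_le_trans xm; lra.
pose F n : set R := if unpickle n is Some s then G s else setT.
have odF n : open (F n) /\ dense (F n).
  rewrite /F; case: unpickle => [s|]; first by split.
  by split; [exact: openT|move=> O O0 _; rewrite setIT].
have [|x [_ Fx]] := @Baire R R^o F odF setT _ openT.
  by exists 0.
have Gx s : G s x.
  by have := Fx (pickle s) Logic.I; rewrite /F pickleK.
exists x; split=> [m m0|i]; [exact: (Gx (inl m))|exact: (Gx (inr i))].
Qed.

(** A finite minimum; it is the reason for asking that no m x with m != 0 be an
    integer. *)
Lemma dist_int_mul_bounded_below (R : realType) (x : R) :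
  (forall m : int, m != 0 -> 0 < dist_int (x *~ m)) -> forall N : nat,
  exists2 delta, 0 < delta & forall m : int, m != 0 -> (`|m| <= N)%N ->
    delta <= dist_int (x *~ m).
Proof.
move=> x0; elim=> [|N [d d0 dN]].
  by exists 1 => // m; rewrite leqn0 absz_eq0 => /negPf ->.
exists (Num.min d (Num.min (dist_int (x *~ N.+1)) (dist_int (x *~ - N.+1%:Z)))).
  by rewrite !lt_min d0 !x0// oppr_eq0.
move=> m m0; rewrite leq_eqVlt => /predU1P[mN|]; last first.
  by rewrite ltnS => mN; rewrite ge_min dN.
rewrite !ge_min; case: m m0 mN => [n|n] _ /= [->]; rewrite ?NegzE lexx !orbT//.
Qed.

(** The generic x splits the closure of the image of the support into points near
    which a is unbounded (first alternative) and points near which it is bounded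
    (second alternative). In the first, eps = 1/4 is the same for all y, so that
    one set of indices handles all of them; in the second, delta may depend on
    the neighbourhood, of which there are only countably many. *)
Lemma generic_dichotomy (R : realType) (e : nat -> R) (a : nat -> int) :
  exists (x : R) (U : nat -> set R), (forall i, open (U i)) /\
    forall y, closure (e @` supp a) y ->
      closure (e @` [set n | 4^-1 <= dist_int (x *~ a n)]) y \/
      exists i, U i y /\ exists2 delta, 0 < delta &
        e @` supp a `&` U i `<=` e @` [set n | delta <= dist_int (x *~ a n)].
Proof.
(* The balls of radius 1/(j+1) about the points e_k: every neighbourhood of a
   point y in the closure contains such a ball that contains y. *)
pose U i : set R :=
  if @unpickle (nat * nat)%type i is Some (k, j) then ball (e k) j.+1%:R^-1
  else set0.
have [x [x0 xU]] := generic_point R a (fun i => [set n | U i (e n)]).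
exists x, U; split=> [i|y Ay].
  rewrite /U; case: unpickle => [[k j]|]; last exact: open0.
  exact: ball_open.
have [[i [Uy [N aN]]]|nb] := pselect (exists i, U i y /\
    exists N : nat, forall n, U i (e n) -> (`|a n| <= N)%N).
  right; exists i; split=> //.
  have [d d0 dN] := dist_int_mul_bounded_below x0 N; exists d => //.
  by move=> _ [[n an <-] Un]; exists n => //=; apply: dN => //; exact: aN.
left=> V /nbhs_ballP[r /= r0 rV].
pose j := Num.truncn (2 / r).
have jr : j.+1%:R^-1 < r / 2.
  by rewrite -[r / 2]invrK ltf_pV2 ?posrE ?invr_gt0 ?divr_gt0// invf_div truncnS_gt.
have [_ [[k _ <-] yk]] := Ay _ (nbhsx_ballx y j.+1%:R^-1 ltac:(by [])).
pose i := pickle (k, j).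
have Ui : U i = ball (e k) j.+1%:R^-1 by rewrite /U pickleK.
have [bi|[n Un an]] := xU i.
  by exfalso; apply: nb; exists i; split => //; rewrite Ui; exact: ball_sym.
exists (e n); split; first by exists n => //=; exact: ltW.
apply: rV; rewrite [r]splitr; apply: (@ball_triangle _ _ (e k)).
  exact: le_ball (ltW jr) _ yk.
by move: Un; rewrite /= Ui; exact: le_ball (ltW jr) _.
Qed.

(** * Ideals detected locally on closures *)

(** What the two ideals have in common, in the form that [generic_dichotomy]
    produces: B collects the points of large ||a_n x||, and the sets U i are the
    balls on which a is bounded. *)
Definition locally_detected (R : realType) (J : set (set R)) :=
  forall (A B : set R) (U : nat -> set R), (forall i, open (U i)) ->
    A `<=` D R -> B `<=` A -> J B ->
    (forall y, closure A y -> closure B y \/ exists i, U i y /\ J (A `&` U i)) ->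
    J A.

Lemma sub_D_unit (R : realType) (A : set R) : A `<=` D R -> A `<=` `[0, 1].
Proof. by move=> AD x /AD[x01 _]; rewrite /= in_itv. Qed.

Lemma closure_unit_space (R : realType) (A : set R) : A `<=` D R ->
  closure (A : set (unit_space R)) = closure A `&` `[0, 1].
Proof. by move=> AD; apply: closure_subspaceW; exact: sub_D_unit. Qed.

Lemma measurable_closure_unit_space (R : realType) (A : set R) : A `<=` D R ->
  measurable (closure (A : set (unit_space R)) : set R).
Proof.
move=> AD; rewrite closure_unit_space//; apply: measurableI => //.
by apply: measurable_realfun.closed_measurable; exact: closed_closure.
Qed.

Lemma nwdS (R : realType) (A B : set R) : A `<=` B -> nwd R B -> nwd R A.
Proof.
move=> AB [BD B0]; split; first exact: subset_trans BD.
apply/seteqP; split=> // x Ax; rewrite -B0.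
exact: (@interiorS (unit_space R) _ _ (@closureS (unit_space R) _ _ AB)).
Qed.

Lemma nullS (R : realType) (A B : set R) : A `<=` B -> null R B -> null R A.
Proof.
move=> AB [BD B0]; have AD := subset_trans AB BD; split=> //.
apply: (@subset_measure0 _ _ _ lebesgue_measure _ _ _ _ _ B0).
- exact: measurable_closure_unit_space.
- exact: measurable_closure_unit_space.
- exact: (@closureS (unit_space R)).
Qed.

Lemma closure_openI (T : topologicalType) (A U : set T) (y : T) :
  open U -> U y -> closure A y -> closure (A `&` U) y.
Proof.
move=> oU Uy Ay V Vy.
have [z [Az [Vz Uz]]] := Ay _ (filterI Vy (open_nbhs_nbhs (conj oU Uy))).
by exists z.
Qed.

(** Let Y be the interior of the closure of A. If Y is not contained in the closure
    of B, it meets some U i, and the nonempty open set Y `&` U i lies in the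
    closure of A `&` U i, contradicting that this trace is nowhere dense. *)
Lemma nwd_locally_detected (R : realType) : locally_detected (nwd R).
Proof.
move=> A B U oU AD BA [BD B0] cov; split=> //.
set X := unit_space R; set Y := interior (closure (A : set X)).
have oY : open (Y : set X) by exact: open_interior.
have YA : Y `<=` closure (A : set X) by exact: interior_subset.
have [YB|] := pselect (Y `<=` closure (B : set X)).
  apply/seteqP; split=> // y Yy; rewrite -B0.
  by have := YB; rewrite (@open_subsetE X)//; exact.
move=> /existsNP[y /not_implyP[Yy nBy]]; exfalso.
have : closure (A : set X) y by exact: YA.
rewrite closure_unit_space// => -[Ay y01].
have [By|[i [Uy [AUD AU0]]]] := cov y Ay.
  by apply: nBy; rewrite closure_unit_space.
have oUi : open (U i : set X) by exact: open_subspaceW.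
have oYU : open (Y `&` U i : set X) by exact: openI.
have YUA : Y `&` U i `<=` closure (A `&` U i : set X).
  by move=> z [Yz Uz]; apply: (@closure_openI X) => //; exact: YA.
suff : (set0 : set X) y by [].
by by rewrite -[set0]AU0;  have := YUA; rewrite (@open_subsetE X)//; exact.
Qed.

(** The closure of A is covered by countably many closures of measure zero. *)
Lemma null_locally_detected (R : realType) : locally_detected (null R).
Proof.
move=> A B U oU AD BA [BD B0] cov; split=> //.
pose cl (C : set R) : set R := closure (C : set (unit_space R)).
pose N i : set R := if pselect (null R (A `&` U i)) then cl (A `&` U i) else set0.
have cl0 C : null R C -> (@lebesgue_measure R).-negligible (cl C).
  move=> [CD C0]; apply/negligibleP => //.
  exact: measurable_closure_unit_space.
have AN : cl A `<=` cl B `|` \bigcup_i N i.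
  rewrite /cl closure_unit_space// => y [Ay y01].
  have [By|[i [Uy nAU]]] := cov y Ay; [left|right; exists i => //].
    by rewrite closure_unit_space.
  rewrite /N; case: pselect => //= _.
  rewrite /cl closure_unit_space; last by case: nAU.
  by split=> //; exact: closure_openI.
apply/negligibleP; first exact: measurable_closure_unit_space.
apply: negligibleS; first exact: AN.
apply: negligibleU; first exact: cl0.
apply: negligible_bigcup => i; rewrite /N.
case: pselect => /= [/cl0//|_]; exact: negligible_set0.
Qed.

(** * The set H and the support *)

(** The hard direction: the generic x is one point at which the hypothesis, used
    for all eps, already forces the support into the ideal. *)
Lemma supp_in_ideal (R : realType) (e : nat -> R) (J : set (set R))
    (a : nat -> int) :
  (forall n, D R (e n)) -> (forall A B, A `<=` B -> J B -> J A) ->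
  locally_detected J ->
  (forall (x eps : R), 0 < eps ->
    J (e @` [set n | eps <= dist_int (x *~ a n)])) ->
  J (e @` supp a).
Proof.
move=> eD JS Jloc HJ; have [x [U [oU dich]]] := generic_dichotomy e a.
apply: (Jloc _ (e @` [set n | 4^-1 <= dist_int (x *~ a n)]) U) => //.
- by move=> _ [n _ <-].
- apply: image_subset => n /= an; apply/eqP => an0.
  by move: an; rewrite an0 mulr0z (dist_int_intr R 0); lra.
- by apply: HJ; lra.
move=> y /dich[|[i [Uy [d d0 AU]]]]; first by left.
by right; exists i; split=> //; apply: JS AU _; exact: HJ.
Qed.

Lemma H_eq_circleP (R : realType) (a : nat -> int) (I : set (set nat)) :
  H R a I = [set: circle R] <->
  forall x eps : R, 0 < eps -> I [set n | eps <= dist_int (x *~ a n)].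
Proof.
have normE x n : circle_norm ((\pi_(circle R) x)%qT *~ a n) = dist_int (x *~ a n).
  by rewrite -circle_piMz circle_norm_pi.
split=> [HT x eps eps0|HI].
  have : H R a I (\pi_(circle R) x)%qT by rewrite HT.
  by move=> /(_ eps eps0); under eq_set do rewrite normE.
apply/seteqP; split=> // x _ eps eps0.
rewrite -[x]reprK; under eq_set do rewrite normE.
exact: HI.
Qed.

Lemma H_eq_circle_iff_supp (R : realType) (e : nat -> R) (J : set (set R))
    (a : nat -> int) :
  (forall n, D R (e n)) -> (forall A B, A `<=` B -> J B -> J A) ->
  locally_detected J ->
  H R a (ideal_on_omega e J) = [set: circle R] <-> ideal_on_omega e J (supp a).
Proof.
move=> eD JS Jloc; rewrite H_eq_circleP; split; first exact: supp_in_ideal.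
move=> Ja x eps eps0; apply: JS Ja; apply: image_subset => n /= an.
by apply/eqP => an0; move: an; rewrite an0 mulr0z (dist_int_intr R 0); lra.
Qed.

Unset Implicit Arguments.

Theorem corollary2p24 (R : realType) (e : nat -> R)
    (he : set_bij [set: nat] (D R) e) (I : set (set nat))
    (hI : I = ideal_on_omega e (nwd R) \/ I = ideal_on_omega e (null R))
    (a : nat -> int) :
  H R a I = [set: circle R] <-> I (supp a).
Proof.
have [/image_subP eD _ _] := he.
case: hI => ->; apply: H_eq_circle_iff_supp.
- by move=> n; exact: eD.
- exact: nwdS.
- exact: nwd_locally_detected.
- by move=> n; exact: eD.
- exact: nullS.
- exact: null_locally_detected.
Qed.
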